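(* Let $2\le m,n<\infty$. The automorphism group of $T_{m,n}$ (equivalently of its associated metric space), with the topology of pointwise convergence, is not amenable unless $m=n=2$.
   Context: $T_{m,n}$ is the countable connected regular tree-like graph in which every block (maximal 2-connected subgraph) is a clique of order $n$ and every vertex is a cut vertex lying in exactly $m$ blocks. A topological group is amenable if every continuous action of it on a nonempty compact Hausdorff space admits an invariant Borel probability measure. *)

(* Defs.v *)
From HB Require Import structures.
From mathcomp Require Import all_boot all_order all_algebra.
From mathcomp Require Import all_classical all_reals all_analysis.

Set Implicit Arguments.
Unset Strict Implicit.
Unset Printing Implicit Defensive.

Local Open Scope classical_set_scope.
Local Open Scope card_scope.

(* Graphs, with an explicit vertex set so that subgraphs need not be induced. *)

Record graph (V : Type) := Graph { vertex : set V ; edge : rel V }.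

Section Graphs.
Variable V : eqType.
Implicit Types (G H B : graph V) (v x y : V).

Definition simple_graph G : Prop :=
  [/\ symmetric (edge G), irreflexive (edge G)
    & forall x y, edge G x y -> vertex G x /\ vertex G y].

Definition subgraph H G : Prop :=
  [/\ simple_graph H, vertex H `<=` vertex G
    & forall x y, edge H x y -> edge G x y].

Definition walk G x y (k : nat) : Prop :=
  exists p : seq V, [/\ path (edge G) x p, last x p = y & size p = k].

Definition joined G x y : Prop := exists k, walk G x y k.

Definition connected_graph G : Prop :=
  vertex G !=set0 /\ forall x y, vertex G x -> vertex G y -> joined G x y.

Definition delete_vertex G v : graph V :=
  Graph (vertex G `\ v) [rel x y | [&& edge G x y, x != v & y != v]].

Definition cut_vertex G v : Prop :=
  vertex G v /\
  exists x y, [/\ vertex (delete_vertex G v) x, vertex (delete_vertex G v) y,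
                  joined G x y & ~ joined (delete_vertex G v) x y].

(* 2-connectedness in the sense used for blocks: K_2 counts as 2-connected
   (otherwise trees, i.e. the case n = 2, would have no blocks). *)
Definition two_connected G : Prop :=
  [/\ connected_graph G,
      exists x y, [/\ vertex G x, vertex G y & x <> y]
    & forall v, ~ cut_vertex G v].

Definition is_block G B : Prop :=
  [/\ subgraph B G, two_connected B
    & forall H, subgraph H G -> two_connected H -> subgraph B H -> H = B].

Definition clique_of_order (n : nat) B : Prop :=
  vertex B #= `I_n /\
  forall x y, vertex B x -> vertex B y -> x <> y -> edge B x y.

(* G is a copy of T_{m,n} with underlying vertex set all of V;
   this determines G up to isomorphism. *)
Definition is_T (m n : nat) G : Prop :=
  [/\ simple_graph G, vertex G = setT, connected_graph G,
      forall B, is_block G B -> clique_of_order n B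
    & forall v, cut_vertex G v /\
        [set B | is_block G B /\ vertex B v] #= `I_m].

(* The path metric; junk value 0 between vertices in different components. *)
Definition graph_dist G x y : nat :=
  xget 0%N [set k | walk G x y k /\ forall j, walk G x y j -> (k <= j)%N].

End Graphs.

HB.mixin Record isTopologicalGroup G & Topological G & Group G := {
  mulg_continuous : continuous (fun z : G * G => (z.1 * z.2)%g) ;
  invg_continuous : continuous (fun x : G => (x^-1)%g)
}.

#[short(type="topGroupType")]
HB.structure Definition TopologicalGroup :=
  {G of Topological G & Group G & isTopologicalGroup G}.

Section Amenability.

Definition continuous_action (G : topGroupType) (X : topologicalType)
    (act : G -> X -> X) : Prop :=
  [/\ forall x, act 1%g x = x,
      forall g h x, act (g * h)%g x = act g (act h x)
    & continuous (fun z : G * X => act z.1 z.2)].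

Definition borel (X : ptopologicalType) := g_sigma_algebraType (@open X).

(* Nonemptiness of X is carried by its base point. *)
Definition amenable (R : realType) (G : topGroupType) : Prop :=
  forall X : ptopologicalType, compact [set: X] -> hausdorff_space X ->
  forall act : G -> X -> X, continuous_action act ->
  exists mu : probability (borel X) R,
    forall (g : G) (A : set (borel X)), measurable A ->
      mu (act g @^-1` A) = mu A.

End Amenability.

(* The permutations of V preserving a binary function S : V -> V -> C.  Taking
   for S the edge relation of a graph gives its automorphisms, and taking for S
   a distance gives the self-isometries. *)
Record autom (V C : Type) (S : V -> V -> C) := Autom {
  autom_fun :> V -> V ;
  autom_bij : bijective autom_fun ;
  autom_pres : forall x y, S (autom_fun x) (autom_fun y) = S x y
}.

Section AutomGroup.
Variables (V C : Type) (S : V -> V -> C).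
Local Notation A := (autom S).

Lemma autom_ext (f g : A) : f =1 g -> f = g.
Proof.
case: f g => [f bf pf] [g bg pg] /= /funext fg; move: bf pf bg pg; rewrite fg.
by move=> bf pf bg pg; congr Autom; exact: Prop_irrelevance.
Qed.

Definition autom_one : A :=
  Autom (inv_bij (fun=> erefl)) (fun _ _ => erefl).

Lemma autom_mul_pres (f g : A) x y : S ((f \o g) x) ((f \o g) y) = S x y.
Proof. by rewrite /= !autom_pres. Qed.

Definition autom_mul (f g : A) : A :=
  Autom (bij_comp (autom_bij f) (autom_bij g)) (autom_mul_pres f g).

Lemma autom_inv_exists (f : A) :
  exists g : A, cancel (f : V -> V) g /\ cancel (g : V -> V) f.
Proof.
have [g fK gK] := autom_bij f.
have gS x y : S (g x) (g y) = S x y by rewrite -(autom_pres f) !gK.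
by exists (Autom (Bijective gK fK) gS).
Qed.

Definition autom_inv (f : A) : A := sval (cid (autom_inv_exists f)).

Lemma autom_invK (f : A) : cancel (f : V -> V) (autom_inv f).
Proof. by rewrite /autom_inv; case: cid => ? []. Qed.

Lemma autom_invKV (f : A) : cancel (autom_inv f : V -> V) f.
Proof. by rewrite /autom_inv; case: cid => ? []. Qed.

HB.instance Definition _ := gen_eqMixin A.
HB.instance Definition _ := gen_choiceMixin A.

Lemma autom_mulA : associative autom_mul.
Proof. by move=> f g h; exact: autom_ext. Qed.
Lemma autom_mul1 : left_id autom_one autom_mul.
Proof. by move=> f; exact: autom_ext. Qed.
Lemma autom_mulr1 : right_id autom_one autom_mul.
Proof. by move=> f; exact: autom_ext. Qed.
Lemma autom_mulV : left_inverse autom_one autom_inv autom_mul.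
Proof. by move=> f; apply: autom_ext => x /=; exact: autom_invK. Qed.
Lemma autom_mulrV : right_inverse autom_one autom_inv autom_mul.
Proof. by move=> f; apply: autom_ext => x /=; exact: autom_invKV. Qed.

HB.instance Definition _ := isGroup.Build A
  autom_mulA autom_mul1 autom_mulr1 autom_mulV autom_mulrV.

End AutomGroup.

Section AutomTopology.
Variables (V : choiceType) (C : Type) (S : V -> V -> C).
Local Notation A := (autom S).

(* Pointwise convergence with V discrete.  An integer-valued metric induces the
   discrete topology, so this is also pointwise convergence in the metric. *)
HB.instance Definition _ := Topological.copy A
  (initial_topology (fun f : A => (f : V -> V) : {ptws V -> discrete_topology V})).

Lemma nbhs_autom (f : A) (x : V) : nbhs f [set g : A | g x = f x].
Proof.
have ci := @initial_continuous A {ptws V -> discrete_topology V}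
  (fun g : A => (g : V -> V)) f.
have cp := @proj_continuous V (fun=> discrete_topology V) x (f : V -> V).
have H := cvg_comp _ _ ci cp.
exact: (H _ (@discrete_set1 (discrete_topology V) (f x))).
Qed.

Lemma cvg_autom (F : set_system A) (f : A) : Filter F ->
  (forall x, F [set g : A | g x = f x]) -> F --> f.
Proof.
move=> FF Fx U /= [_ [[B oB <-] Bf sBU]].
have : (fun g : A => (g : V -> V)) @ F -->
    ((f : V -> V) : {ptws discrete_topology V -> discrete_topology V}).
  apply/(@pointwise_cvgP (discrete_topology V) (discrete_topology V)) => t.
  by apply/discrete_cvg; exact: Fx.
move=> /(_ B); rewrite /= nbhs_filterE => FB; apply: filterS sBU _; apply: FB.
exact: open_nbhs_nbhs.
Qed.

Lemma autom_mul_continuous : continuous (fun z : A * A => (z.1 * z.2)%g).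
Proof.
move=> [f g]; apply: cvg_autom => x.
exists ([set f' : A | f' (g x) = f (g x)], [set g' : A | g' x = g x]).
  by split; exact: nbhs_autom.
by move=> [f' g'] /= [+ g'x]; rewrite /= g'x.
Qed.

Lemma autom_inv_continuous : continuous (fun f : A => (f^-1)%g).
Proof.
move=> f; have FF : Filter ((fun g : A => (g^-1)%g) @ nbhs f).
  exact: (@fmap_filter _ _ _ _ (nbhs_filter f)).
apply: cvg_autom => x.
apply: filterS (nbhs_autom f ((f^-1)%g x)) => g /= gx.
have fx : f ((f^-1)%g x) = x by exact: autom_invKV.
by rewrite -[in LHS]fx -gx; exact: autom_invK.
Qed.

HB.instance Definition _ :=
  isTopologicalGroup.Build A autom_mul_continuous autom_inv_continuous.

End AutomTopology.

Definition graph_aut (V : choiceType) (G : graph V) : topGroupType :=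
  autom (edge G).

Definition isometry_group (V : choiceType) (G : graph V) : topGroupType :=
  autom (graph_dist G).

(* Main.v *)
Require Import Defs.
From HB Require Import structures.
From mathcomp Require Import all_boot all_order all_algebra.
From mathcomp Require Import all_classical all_reals all_analysis.

(* Let a doubling be an injective map c : V * bool -> V with c (x, b) adjacent
   to x.  Since T is locally finite the doublings form a compact space, on which
   automorphisms act by conjugation.  For an invariant probability mu, the mass
   mu{c (x, b) = y} is symmetric in adjacent x, y as soon as some automorphism
   swaps them; summing over the neighbours y of x gives a total outgoing mass 2
   (one for each b), while injectivity bounds the incoming mass by 1.

   Both the swaps and a doubling come from coding the vertices.  Distinct blocks
   at x are separated by x, for a path joining them off x would make their union
   part of a larger 2-connected subgraph.  Hence, starting from a block B0, each
   vertex is reached from a unique vertex of B0 by a unique word whose letters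
   choose one of the m - 1 blocks other than the current one and one of the
   n - 1 other vertices of that block.  Transposing two vertices of B0 while
   keeping the words is an automorphism, and appending one of two distinct
   letters, which exist because (m - 1)(n - 1) > 1, is a doubling. *)

Set Implicit Arguments.
Unset Strict Implicit.
Unset Printing Implicit Defensive.

Local Open Scope classical_set_scope.
Local Open Scope card_scope.

(** * Walks, connectivity and 2-connectedness *)

Section Joined.
Variable V : eqType.
Implicit Types (G H B : graph V) (v x y z : V).

Lemma joined_path G x p : path (edge G) x p -> joined G x (last x p).
Proof. by move=> ep; exists (size p), p. Qed.

Lemma joined_refl G x : joined G x x.
Proof. exact: (@joined_path G x [::]). Qed.

Lemma joined_edge G x y : edge G x y -> joined G x y.
Proof. by move=> exy; apply: (@joined_path G x [:: y]); rewrite /= exy. Qed.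

Lemma joined_trans G y x z : joined G x y -> joined G y z -> joined G x z.
Proof.
move=> [_ [p [ep <- _]]] [_ [q [eq <- _]]]; rewrite -last_cat.
by apply: joined_path; rewrite cat_path ep.
Qed.

Lemma joined_sym G x y : symmetric (edge G) -> joined G x y -> joined G y x.
Proof.
move=> sG [_ [p [ep <- _]]]; elim: p x ep => [|z p IHp] x /=.
  by move=> _; exact: joined_refl.
case/andP=> exz ep; apply: joined_trans (IHp _ ep) _.
by apply: joined_edge; rewrite sG.
Qed.

Lemma joined_ind G (P : V -> Prop) x y :
  (forall u w, edge G u w -> P u -> P w) -> joined G x y -> P x -> P y.
Proof.
move=> eP [_ [p [ep <- _]]]; elim: p x ep => //= z p IHp x /andP[exz ep] Px.
exact: IHp ep (eP _ _ exz Px).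
Qed.

Lemma joined_mono G H x y : (forall u w, edge G u w -> edge H u w) ->
  joined G x y -> joined H x y.
Proof.
move=> GH Gxy; apply: (joined_ind _ Gxy) (joined_refl H x) => u w euw Hxu.
exact: joined_trans Hxu (joined_edge (GH _ _ euw)).
Qed.

Lemma joined_delete_mono G H v x y : (forall u w, edge G u w -> edge H u w) ->
  joined (delete_vertex G v) x y -> joined (delete_vertex H v) x y.
Proof.
by move=> GH; apply: joined_mono => u w /= /and3P[/GH -> -> ->].
Qed.

Lemma delete_vertex_sym G v :
  symmetric (edge G) -> symmetric (edge (delete_vertex G v)).
Proof. by move=> sG x y /=; rewrite sG [X in _ && X]andbC. Qed.

Lemma two_connected_joined_delete G v x y :
  simple_graph G -> two_connected G -> vertex G x -> vertex G y ->
  x <> v -> y <> v -> joined (delete_vertex G v) x y.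
Proof.
move=> [_ _ vG] [[_ cG] _ ncut] Gx Gy xv yv.
have [Gv|nGv] := pselect (vertex G v).
  apply: contrapT => nj; apply: (ncut v); split=> //; exists x, y.
  by split => //; apply: cG.
(* Deleting a vertex outside [G] removes no edge. *)
apply: joined_mono (cG _ _ Gx Gy) => u w /= euw; rewrite euw /=.
by have [Gu Gw] := vG _ _ euw; apply/andP; split; apply/eqP => uv; apply: nGv;
   rewrite -uv.
Qed.

Lemma two_connected_joined G x y :
  two_connected G -> vertex G x -> vertex G y -> joined G x y.
Proof. by case=> -[_ cG] _ _; exact: cG. Qed.

Lemma two_connectedP G x y : vertex G x -> vertex G y -> x <> y ->
  (forall u w, vertex G u -> vertex G w -> joined G u w) ->
  (forall v u w, vertex G u -> vertex G w -> u <> v -> w <> v ->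
    joined (delete_vertex G v) u w) ->
  two_connected G.
Proof.
move=> Gx Gy xy cG dG; split; first by split=> //; exists x.
  by exists x, y.
by move=> v [Gv [u [w [[Gu uv] [Gw wv] _]]]]; apply; apply: dG.
Qed.

Lemma subgraph_anti G H : subgraph G H -> subgraph H G -> G = H.
Proof.
case: G H => [VG eG] [VH eH] [_ /= VGH eGH] [_ /= VHG eHG].
congr Graph; first exact/seteqP.
by apply/funext => x; apply/funext => y; apply/idP/idP; [apply: eGH|apply: eHG].
Qed.

End Joined.

(** * Every edge lies in a block, and two blocks at a vertex are separated by it *)

Section Blocks.
Variables (V : eqType) (G : graph V).
Hypothesis simpleG : simple_graph G.
Implicit Types (B C H : graph V) (u v x y z : V).

Let symG : symmetric (edge G). Proof. by case: simpleG. Qed.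

Lemma block_simple B : is_block G B -> simple_graph B.
Proof. by case=> -[]. Qed.

Section EdgeBlock.
Variables x y : V.

Definition edge_block_member H :=
  [/\ subgraph H G, two_connected H & edge H x y].

(** Taking the union of all 2-connected subgraphs through the edge makes maximality automatic; only
    2-connectedness of the union has to be proved. *)
Definition edge_block : graph V :=
  Graph [set v | exists2 H, edge_block_member H & vertex H v]
    [rel u w | `[< exists2 H, edge_block_member H & edge H u w >]].

Lemma edge_block_edge H u w :
  edge_block_member H -> edge H u w -> edge edge_block u w.
Proof. by move=> mH eH; apply/asboolP; exists H. Qed.

Hypothesis Gxy : edge G x y.

(** The copy of [K_2] on the given edge, showing that the family of members is inhabited. *)
Let edge_graph : graph V :=
  Graph [set v | v = x \/ v = y]
    [rel u w | ((u == x) && (w == y)) || ((u == y) && (w == x))].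

Lemma edge_block_member_edge : edge_block_member edge_graph.
Proof.
have [_ iG vG] := simpleG.
have xy : x <> y by move=> xy; have := Gxy; rewrite xy iG.
have yx : y <> x by move/esym.
have exy : edge edge_graph x y by rewrite /= !eqxx.
have eyx : edge edge_graph y x by rewrite /= !eqxx orbT.
split=> //.
  split.
  - split.
    + by move=> u w /=; rewrite orbC; congr orb; rewrite andbC.
    + move=> u /=; apply/negP => /orP[] /andP[/eqP -> /eqP].
        exact: xy.
      exact: yx.
    + by move=> u w /= /orP[] /andP[/eqP -> /eqP ->]; split; auto.
  - by move=> u /= [] ->; have [] := vG _ _ Gxy.
  - move=> u w /= /orP[] /andP[/eqP -> /eqP ->] //.
    by rewrite symG.
apply: (@two_connectedP _ _ x y) => //=; [by left|by right| |].
- move=> u w [->|->] [->|->]; by [exact: joined_refl|exact: joined_edge].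
- move=> v u w [->|->] [->|->] uv wv; try exact: joined_refl.
  all: by apply: joined_edge; rewrite /= !eqxx ?orbT /=; apply/andP; split;
    exact/eqP.
Qed.

(* Deleting a vertex leaves one of the ends of the common edge in every
   member, so the pieces stay connected to each other through it. *)
Lemma edge_block_is_block : is_block G edge_block.
Proof.
have [_ iG vG] := simpleG.
have xy : x <> y by move=> xy; have := Gxy; rewrite xy iG.
have mE := edge_block_member_edge.
have mG H u w : edge_block_member H -> edge H u w -> edge edge_block u w.
  exact: edge_block_edge.
have mx H : edge_block_member H -> vertex H x /\ vertex H y.
  by case=> -[[_ _ vH] _ _] _; exact: vH.
have sB : subgraph edge_block G.
  split.
  - split.
    + move=> u w; apply/asboolP/asboolP => -[H mH eH]; exists H => //;
        by case: (mH) => -[[sH _ _] _ _] _ _; rewrite sH.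
    + move=> u; apply/asboolP => -[H [[[_ iH _] _ _] _ _]].
      by rewrite iH.
    + move=> u w /asboolP[H mH eH]; case: (mH) => -[[_ _ vH] _ _] _ _.
      by have [Hu Hw] := vH _ _ eH; split; exists H.
  - by move=> v [H [[_ sH _] _ _] /sH].
  - by move=> u w /asboolP[H [[_ _ sH] _ _] /sH].
have sym : symmetric (edge edge_block) by case: sB => -[].
have tB : two_connected edge_block.
  apply: (@two_connectedP _ _ x y) => //.
  - by exists edge_graph => //; have [] := mx _ mE.
  - by exists edge_graph => //; have [] := mx _ mE.
  - have jx u : vertex edge_block u -> joined edge_block u x.
      case=> H mH Hu; apply: (joined_mono (fun _ _ => mG H _ _ mH)).
      case: (mH) => _ tH _; apply: two_connected_joined => //.
      by have [] := mx _ mH.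
    move=> u w /jx ux /jx wx; apply: joined_trans ux _.
    exact: joined_sym.
  - move=> v; have [a [av am]] : exists a, a <> v /\
        forall H, edge_block_member H -> vertex H a.
      have [<-|xv] := pselect (x = v).
        by exists y; split=> [/esym //|H /mx[]].
      by exists x; split=> // H /mx[].
    have jx u : vertex edge_block u -> u <> v ->
        joined (delete_vertex edge_block v) u a.
      case=> H mH Hu uv.
      apply: (joined_delete_mono (fun _ _ => mG H _ _ mH)).
      case: (mH) => -[iH _ _] tH _.
      by apply: two_connected_joined_delete => //; apply: am.
    move=> u w Bu Bw uv wv; apply: joined_trans (jx _ Bu uv) _.
    by apply: joined_sym (jx _ Bw wv); exact: delete_vertex_sym.
split=> // H sH tH [_ vBH eBH].
(* A 2-connected [H] containing the union contains the edge, so it is itself a member and lies in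
   the union. *)
have mH : edge_block_member H.
  by split=> //; apply: eBH; apply: mG mE _; rewrite /= !eqxx.
apply: subgraph_anti.
  split; first by case: sH.
    by move=> u Hu; exists H.
  by move=> u w; exact: mG.
by split=> //; case: sB.
Qed.

Lemma edge_in_block : exists B, [/\ is_block G B, vertex B x & vertex B y].
Proof.
have iB := edge_block_is_block.
exists edge_block; split=> //.
all: have [_ _ vB] := block_simple iB.
all: have mE := edge_block_member_edge.
all: have /vB[] // : edge edge_block x y.
all: by apply: edge_block_edge mE _; rewrite /= !eqxx.
Qed.

End EdgeBlock.

Section TwoBlocks.
Variables (B C : graph V) (x y : V) (p : seq V).
Hypotheses (iB : is_block G B) (iC : is_block G C).
Hypotheses (Bx : vertex B x) (Cx : vertex C x).
Hypotheses (By : vertex B y) (Cz : vertex C (last y p)).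
Hypotheses (yx : y <> x) (zx : last y p <> x).
Hypothesis ep : path (edge (delete_vertex G x)) y p.
Hypothesis up : uniq (y :: p).

(** All edges off [x] among the vertices of the path are kept, not only the consecutive ones; the
    relation is then symmetric by form. *)
Let path_edge : rel V := fun u w =>
  [&& u \in y :: p, w \in y :: p & edge (delete_vertex G x) u w].

(** The two blocks with a path between them avoiding [x]: the candidate for a larger 2-connected
    subgraph. *)
Let ear : graph V :=
  Graph [set v | [\/ vertex B v, vertex C v | v \in y :: p]]
    [rel u w | [|| edge B u w, edge C u w | path_edge u w]].

Let path_edgeP : path path_edge y p.
Proof.
apply/(pathP y) => i ip; have := pathP y ep i ip => e.
rewrite /path_edge e andbT; apply/andP; split.
  exact: mem_nth (ltnW _).
by rewrite inE mem_nth ?orbT.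
Qed.

Let ear_sym : symmetric (edge ear).
Proof.
move=> u w; have [[sB _ _] [sC _ _]] := (block_simple iB, block_simple iC).
rewrite /= sB sC /path_edge /= symG [in RHS]andbCA.
by rewrite [(u != x) && _]andbC.
Qed.

Let ear_path_delete v w q : path (edge ear) w q -> v \notin w :: q ->
  joined (delete_vertex ear v) w (last w q).
Proof.
move=> eq vq; apply: joined_path; elim: q w eq vq => //= z q IHq w.
case/andP=> ewz eq; rewrite inE negb_or => /andP[vw vzq].
rewrite IHq // andbT ewz eq_sym vw /=.
by move: vzq; rewrite inE negb_or eq_sym => /andP[].
Qed.

(** A simple path meets [v] at most once, so [v] is missing from the piece before [z] or from the
    piece after it. *)
Let ear_path_ends v z : z \in y :: p -> z <> v ->
  (y <> v /\ joined (delete_vertex ear v) y z) \/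
  (last y p <> v /\ joined (delete_vertex ear v) z (last y p)).
Proof.
move=> zp zv.
have : path (edge ear) y p.
  by apply: sub_path path_edgeP => u w /= ->; rewrite !orbT.
have [p1 [p2 [pE lz]]] : exists p1 p2, p = p1 ++ p2 /\ last y p1 = z.
  by case/splitPl: zp => p1 p2 lp; exists p1, p2.
rewrite {1}pE cat_path => /andP[e1 e2].
have [vp1|vp1] := boolP (v \in y :: p1); last first.
  left; split; last by rewrite -lz; exact: ear_path_delete.
  by move=> yv; move: vp1; rewrite -yv mem_head.
have vp2 : v \notin z :: p2.
  have := up; rewrite pE -cat_cons cat_uniq inE => /and3P[_ /hasPn nv _].
  rewrite negb_or; apply/andP; split; first by apply/eqP => /esym.
  by apply/negP => /nv /=; rewrite vp1.
have zE : last y p = last z p2 by rewrite pE last_cat lz.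
rewrite zE; rewrite lz in e2; right; split; last exact: ear_path_delete.
by move=> zpv; move: vp2; rewrite -zpv mem_last.
Qed.

Let block_joined A v u w : subgraph A ear -> two_connected A ->
  vertex A u -> vertex A w -> u <> v -> w <> v ->
  joined (delete_vertex ear v) u w.
Proof.
move=> [iA _ sA] tA Au Aw uv wv; apply: (joined_delete_mono sA).
exact: two_connected_joined_delete.
Qed.

Let subBear : subgraph B ear.
Proof.
split; first exact: block_simple.
  by move=> u Bu; constructor 1.
by move=> u w /= ->.
Qed.

Let subCear : subgraph C ear.
Proof.
split; first exact: block_simple.
  by move=> u Cu; constructor 2.
by move=> u w /= ->; rewrite orbT.
Qed.

Let tB : two_connected B. Proof. by case: iB. Qed.
Let tC : two_connected C. Proof. by case: iC. Qed.

(** The path survives the deletion of [x] and links what is left of [B] to what is left of [C]. *)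
Let ear_joined_y u : vertex ear u -> u <> x -> joined (delete_vertex ear x) u y.
Proof.
have ds := delete_vertex_sym x ear_sym.
have zy : joined (delete_vertex ear x) (last y p) y.
  have xp : x \notin y :: p.
    rewrite inE negb_or; apply/andP; split; first by apply/eqP => /esym.
    apply/negP => /(nthP y)[i ip xE].
    by have /and3P[_ _] := pathP y ep i ip; rewrite xE eqxx.
  apply: joined_sym => //; apply: ear_path_delete => //.
  by apply: sub_path path_edgeP => a b /= ->; rewrite !orbT.
move=> [Bu|Cu|up'] ux.
- exact: (block_joined subBear).
- by apply: joined_trans zy; apply: (block_joined subCear).
- have [[_ yu]|[_ uz]] := ear_path_ends up' ux; first exact: joined_sym.
  exact: joined_trans uz zy.
Qed.

(** When [x] survives, it is a common vertex of [B] and [C], and every remaining path vertex still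
    reaches one of the two blocks. *)
Let ear_joined_x v u : v <> x -> vertex ear u -> u <> v ->
  joined (delete_vertex ear v) u x.
Proof.
have ds := delete_vertex_sym v ear_sym.
move=> /nesym xv [Bu|Cu|up'] uv.
- exact: (block_joined subBear).
- exact: (block_joined subCear).
- have [[yv yu]|[zv uz]] := ear_path_ends up' uv.
    by apply: joined_trans (joined_sym ds yu) _; apply: (block_joined subBear).
  by apply: joined_trans uz _; apply: (block_joined subCear).
Qed.

Let ear_subgraph : subgraph ear G.
Proof.
have [[[sB iB' vB] sBG eBG] _ _] := iB.
have [[[sC iC' vC] sCG eCG] _ _] := iC.
have [_ iG vG] := simpleG.
split.
- split=> //.
  + by move=> u /=; rewrite iB' iC' /path_edge /= iG !andbF.
  + move=> u w /= /or3P[/vB[]|/vC[]|/and3P[]] *; split;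
    by [constructor 1|constructor 2|constructor 3].
- move=> u [/sBG|/sCG|] //; rewrite inE => /orP[/eqP ->|up'].
    exact: sBG.
  have [i ip <-] := nthP y up'.
  by have /and3P[/vG[_]] := pathP y ep i ip.
- by move=> u w /= /or3P[/eBG|/eCG|/and3P[_ _ /and3P[]]].
Qed.

(** The ear is 2-connected and contains both blocks, so by maximality each of them equals it. *)
Lemma two_blocks_cycle : B = C.
Proof.
have [_ _ mB] := iB; have [_ _ mC] := iC.
have ear_x : vertex ear x by constructor 1.
have ear_y : vertex ear y by constructor 1.
have tear : two_connected ear.
  apply: (two_connectedP ear_x ear_y) => [/esym //||].
    have jx u : vertex ear u -> joined ear u x.
      have [-> _|ux ear_u] := pselect (u = x); first exact: joined_refl.
      apply: (@joined_trans _ _ y).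
        apply: joined_mono (ear_joined_y ear_u ux).
        by move=> a b /and3P[].
      have := two_connected_joined tB By Bx.
      by apply: joined_mono => a b /= ->.
    move=> u w /jx ux /jx wx; apply: joined_trans ux _.
    exact: joined_sym.
  move=> v u w ear_u ear_w uv wv.
  have ds := delete_vertex_sym v ear_sym.
  have [vx|vx] := pselect (v = x).
    apply: (@joined_trans _ _ y).
      by rewrite vx in uv *; exact: ear_joined_y.
    by apply: joined_sym => //; rewrite vx in wv *; exact: ear_joined_y.
  apply: joined_trans (ear_joined_x vx ear_u uv) _.
  exact: joined_sym (ear_joined_x vx ear_w wv).
by rewrite -(mB ear) // -(mC ear).
Qed.

End TwoBlocks.

End Blocks.

Lemma blocks_separated (V : eqType) (G : graph V) B C x y z :
  simple_graph G -> is_block G B -> is_block G C -> vertex B x -> vertex C x ->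
  vertex B y -> vertex C z -> y <> x -> z <> x ->
  joined (delete_vertex G x) y z -> B = C.
Proof.
move=> sG iB iC Bx Cx By Cz yx zx [_ [p [ep lp _]]].
(* The walk may repeat vertices, so it is first shortened to a simple path with the same ends. *)
rewrite -{z}lp in Cz zx; case: (shortenP ep) Cz zx => q eq uq _ Cz zx.
exact: (two_blocks_cycle sG iB iC Bx Cx By Cz yx zx eq uq).
Qed.

(** * Enumerations of finite sets *)

Lemma card_eq_II_enum (T : Type) (A : set T) k : A #= `I_k ->
  exists f : 'I_k -> T, injective f /\ forall x, A x <-> exists i, f i = x.
Proof.
move=> /card_set_bijP[h [hA /= hinj hsurj]].
have /choice[f fP] : forall i : 'I_k, exists x, A x /\ h x = i.
  by move=> i; have [x Ax hx] := hsurj i (ltn_ord i); exists x.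
exists f; split=> [i j fij|x].
  by apply: val_inj; rewrite /= -(fP i).2 -(fP j).2 fij.
split=> [Ax|[i <-]]; last by have [] := fP i.
exists (Ordinal (hA _ Ax)); have [Af hf] := fP (Ordinal (hA _ Ax)).
by apply: hinj => //; rewrite inE.
Qed.

Lemma card_eq_II_enumD1 (T : Type) (A : set T) k a : A #= `I_k -> A a ->
  exists f : 'I_k.-1 -> T,
    injective f /\ forall x, A x /\ x <> a <-> exists i, f i = x.
Proof.
move=> /card_eq_II_enum[f [finj fA]] /fA[i0 fi0]; move: f finj fA i0 fi0.
case: k => [|k] /= f finj fA i0 fi0; first by case: i0 fi0.
(* [lift i0] runs through the indices other than that of [a]. *)
exists (fun i => f (lift i0 i)); split=> [i j /finj /lift_inj //|x].
split=> [[/fA[i <-]] fia|[i <-]].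
  case: (unliftP i0 i) => [j ->|ii0]; first by exists j.
  by case: fia; rewrite ii0.
split; first by apply/fA; eexists.
rewrite -fi0 => /finj/eqP.
by rewrite eq_sym (negPf (neq_lift _ _)).
Qed.

(** * Branches, cones and the coding of vertices by words *)

Section Coding.
Variables (V : eqType) (G : graph V) (m n : nat).
Hypothesis GT : is_T m n G.
Implicit Types (B C P : graph V) (x y z : V).

Let simpleG : simple_graph G. Proof. by case: GT. Qed.
Let symG : symmetric (edge G). Proof. by case: simpleG. Qed.
Let irrG : irreflexive (edge G). Proof. by case: simpleG. Qed.

Lemma joinedT x y : joined G x y.
Proof. by case: GT => _ vG [_ cG] _ _; apply: cG; rewrite vG. Qed.

Lemma block_card B : is_block G B -> vertex B #= `I_n.
Proof. by case: GT => _ _ _ H _ /H[]. Qed.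

Lemma block_edge B x y :
  is_block G B -> vertex B x -> vertex B y -> x <> y -> edge G x y.
Proof.
move=> iB Bx By xy; have [[_ _ sB] _ _] := iB; apply: sB.
by case: GT => _ _ _ /(_ _ iB)[_]; auto.
Qed.

Lemma blocks_card x : [set B | is_block G B /\ vertex B x] #= `I_m.
Proof. by case: GT => _ _ _ _ /(_ x)[]. Qed.

(** The branch of [G] at [x] in the direction of the block [B]. *)
Definition seen x B z : Prop :=
  exists y, [/\ vertex B y, y <> x & joined (delete_vertex G x) y z].

Lemma seen_refl x B y : vertex B y -> y <> x -> seen x B y.
Proof. by move=> By yx; exists y; split=> //; exact: joined_refl. Qed.

Lemma seen_neq x B z : seen x B z -> z <> x.
Proof.
case=> y [_ yx yz]; apply: (joined_ind (P := fun t => t <> x) _ yz yx) => u w.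
by move=> /and3P[_ _ /eqP].
Qed.

Lemma seen_edge x B z w : seen x B z -> edge G z w -> w <> x -> seen x B w.
Proof.
move=> s zw wx; have zx := seen_neq s; case: s => y [By yx yz].
exists y; split=> //; apply: joined_trans yz _; apply: joined_edge.
by rewrite /= zw /=; apply/andP; split; apply/eqP.
Qed.

Lemma seen_disjoint x B C z : is_block G B -> is_block G C ->
  vertex B x -> vertex C x -> seen x B z -> seen x C z -> B = C.
Proof.
move=> iB iC Bx Cx [y [By yx yz]] [w [Cw wx wz]].
apply: (@blocks_separated _ G B C x y w) => //; apply: joined_trans yz _.
by apply: joined_sym => //; exact: delete_vertex_sym.
Qed.

(** A walk that starts in [C] and avoids [y] cannot reach [x], since that would join [C] to [B] off
    [y]. Its start is adjacent to [y], so the whole walk stays in the branch of [B] at [x]. *)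
Lemma seen_nested x B y C z : is_block G B -> is_block G C ->
  vertex B x -> vertex B y -> y <> x -> vertex C y -> C <> B ->
  seen y C z -> seen x B z.
Proof.
move=> iB iC Bx By yx Cy CB [w [Cw wy wz]].
have nx t : joined (delete_vertex G y) w t -> t <> x.
  move=> wt tx; apply: CB.
  apply: (@blocks_separated _ G C B y w x) => //.
    by move/esym.
  by rewrite -tx.
have wx : w <> x by apply: nx; exact: joined_refl.
have sw : seen x B w.
  apply: seen_edge (seen_refl By yx) _ wx.
  by apply: (block_edge iC) => // /esym.
have [] // : joined (delete_vertex G y) w z /\ seen x B z.
pose Q t := joined (delete_vertex G y) w t /\ seen x B t.
apply: (joined_ind (P := Q) _ wz); last by split=> //; exact: joined_refl.
move=> u t eut [wu su].
have wt := joined_trans wu (joined_edge eut); split=> //.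
have /and3P[Gut _ _] := eut.
by apply: seen_edge su Gut _; apply: nx.
Qed.

(** A vertex together with the block through which it is entered. *)
Definition state := (V * graph V)%type.
Implicit Type s : state.

Definition valid s := is_block G s.2 /\ vertex s.2 s.1.

(** The part of [G] lying behind [s.1] when it is entered through [s.2]. *)
Definition cone s z : Prop := z = s.1 \/
  exists B, [/\ is_block G B, vertex B s.1, B <> s.2 & seen s.1 B z].

(** A branch at [s.1] can only be left through [s.1] itself. *)
Lemma cone_boundary s z w : cone s z -> edge G z w -> ~ cone s w ->
  z = s.1.
Proof.
move=> [//|[B [iB Bs BP sz]]] zw nw; exfalso; apply: nw.
have [ws|ws] := pselect (w = s.1); first by left.
by right; exists B; split=> //; exact: seen_edge zw ws.
Qed.

Lemma cone_seen x B y z : is_block G B -> vertex B x -> vertex B y -> y <> x ->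
  cone (y, B) z -> seen x B z.
Proof.
move=> iB Bx By yx [->|[C [iC Cy CB]]]; first exact: seen_refl.
exact: seen_nested.
Qed.

(** If [x] and [y] differ, the cone at [x] lies in the branch of [B] at [y], which is disjoint from
    the branches through the other blocks at [y]. *)
Lemma cone_sibling x y B z : is_block G B -> vertex B x -> vertex B y ->
  cone (x, B) z -> cone (y, B) z -> x = y.
Proof.
move=> iB Bx By cx cy; apply: contrapT => xy.
have sy := cone_seen iB By Bx xy cx.
case: cy => [/= zy|[C [iC Cy CB /= sC]]]; first exact: (seen_neq sy).
by apply: CB; apply: seen_disjoint sC sy.
Qed.

Definition letter := ('I_m.-1 * 'I_n.-1)%type.

Lemma next_block_exists s : exists nb : 'I_m.-1 -> graph V,
  valid s -> injective nb /\
    forall B, (is_block G B /\ vertex B s.1) /\ B <> s.2 <-> exists i, nb i = B.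
Proof.
(* Invalid states receive a constant junk family, so that choice yields a total function. *)
have [vs|nvs] := pselect (valid s); last by exists (fun=> s.2).
by have [f fP] := card_eq_II_enumD1 (blocks_card s.1) vs; exists f.
Qed.

Definition next_block := projT1 (choice next_block_exists).

Lemma next_vertex_exists s : exists nv : 'I_n.-1 -> V,
  valid s -> injective nv /\
    forall y, vertex s.2 y /\ y <> s.1 <-> exists i, nv i = y.
Proof.
have [vs|nvs] := pselect (valid s); last by exists (fun=> s.1).
by have [f fP] := card_eq_II_enumD1 (block_card vs.1) vs.2; exists f.
Qed.

Definition next_vertex := projT1 (choice next_vertex_exists).

(** [(s.1, B)] is an intermediate state: relative to it, [next_vertex] lists the vertices of [B]
    other than [s.1]. *)
Definition next s (l : letter) : state :=
  let B := next_block s l.1 in (next_vertex (s.1, B) l.2, B).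

Fixpoint run s (w : seq letter) : state :=
  if w is l :: w' then run (next s l) w' else s.

Lemma next_blockP s i : valid s ->
  [/\ is_block G (next_block s i), vertex (next_block s i) s.1 &
      next_block s i <> s.2].
Proof.
move=> /(projT2 (choice next_block_exists)) [_ nbP].
by have [|[]] := (nbP (next_block s i)).2; first by exists i.
Qed.

Lemma next_block_inj s : valid s -> injective (next_block s).
Proof. by move=> /(projT2 (choice next_block_exists)) []. Qed.

Lemma next_block_surj s B : valid s -> is_block G B -> vertex B s.1 ->
  B <> s.2 -> exists i, next_block s i = B.
Proof.
move=> /(projT2 (choice next_block_exists)) [_ nbP] iB Bs BP.
by apply/nbP.
Qed.

Lemma next_vertexP s i : valid s ->
  vertex s.2 (next_vertex s i) /\ next_vertex s i <> s.1.
Proof.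
move=> /(projT2 (choice next_vertex_exists)) [_ nvP].
by apply/nvP; exists i.
Qed.

Lemma next_vertex_inj s : valid s -> injective (next_vertex s).
Proof. by move=> /(projT2 (choice next_vertex_exists)) []. Qed.

Lemma next_vertex_surj s y : valid s -> vertex s.2 y -> y <> s.1 ->
  exists i, next_vertex s i = y.
Proof.
by move=> /(projT2 (choice next_vertex_exists)) [_ nvP] Py ys; apply/nvP.
Qed.

Lemma next_block_valid s i : valid s -> valid (s.1, next_block s i).
Proof. by move=> /(next_blockP i)[]. Qed.

Lemma next_neq s l : valid s -> (next s l).1 <> s.1.
Proof. by move=> /(next_block_valid l.1)/(next_vertexP l.2)[]. Qed.

Lemma next_valid s l : valid s -> valid (next s l).
Proof.
move=> vs; have vb := next_block_valid l.1 vs.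
by split; [case: vb|case: (next_vertexP l.2 vb)].
Qed.

Lemma next_edge s l : valid s -> edge G s.1 (next s l).1.
Proof.
move=> vs; have [iB Bs] := next_block_valid l.1 vs.
have [_ Bn] := next_valid l vs.
by apply: (block_edge iB) => //; move/esym; exact: next_neq.
Qed.

Lemma run_valid s w : valid s -> valid (run s w).
Proof. by elim: w s => //= l w IHw s vs; apply/IHw/next_valid. Qed.

Lemma cone_next_seen s l z : valid s -> cone (next s l) z ->
  seen s.1 (next s l).2 z.
Proof.
move=> vs; have [iB Bs] := next_block_valid l.1 vs.
have [_ Bn] := next_valid l vs.
by apply: cone_seen => //; exact: next_neq.
Qed.

Lemma cone_next s l : valid s -> cone (next s l) `<=` cone s.
Proof.
move=> vs z cz; right; exists (next s l).2.
have [iB Bs BP] := next_blockP l.1 vs.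
by split=> //; exact: cone_next_seen.
Qed.

(** Disjointness of branches at [s.1] forces the same block, and then [cone_sibling] the same vertex
    in it. *)
Lemma cone_next_inj s l l' z : valid s ->
  cone (next s l) z -> cone (next s l') z -> l = l'.
Proof.
move=> vs cl cl'; have [iB Bs _] := next_blockP l.1 vs.
have [iB' Bs' _] := next_blockP l'.1 vs.
have ll1 : l.1 = l'.1.
  apply: (next_block_inj vs).
  exact: (seen_disjoint iB iB' Bs Bs' (cone_next_seen vs cl)
    (cone_next_seen vs cl')).
case: l l' ll1 cl cl' {iB' Bs' iB Bs} => [i a] [_ b] /= <- cl cl'; congr pair.
have vb := next_block_valid i vs.
apply: (next_vertex_inj vb); apply: (cone_sibling vb.1) cl cl'.
  by have [] := next_vertexP a vb.
by have [] := next_vertexP b vb.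
Qed.

Lemma run_cone s w : valid s -> cone s (run s w).1.
Proof.
elim: w s => [|l w IHw] s vs /=; first by left.
exact: cone_next (IHw _ (next_valid l vs)).
Qed.

(** A nonempty word leads into a branch at the start, hence never back to it. Two nonempty words
    with the same end have first letters with overlapping cones, so these letters agree. *)
Lemma run_inj s w w' : valid s -> (run s w).1 = (run s w').1 -> w = w'.
Proof.
have nE s1 l u : valid s1 -> (run (next s1 l) u).1 <> s1.1.
  move=> v1; apply: seen_neq (cone_next_seen v1 _).
  by apply: run_cone; exact: next_valid.
elim: w w' s => [|l w IHw] [|l' w'] s vs //= e.
- by case: (nE s l' w').
- by case: (nE s l w).
- have ll' : l = l'.
    apply: (cone_next_inj vs (z := (run (next s l) w).1)).
      exact: run_cone (next_valid _ vs).
    by rewrite e; exact: run_cone (next_valid _ vs).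
  by rewrite -ll' in e *; rewrite (IHw _ _ (next_valid l vs) e).
Qed.

(** Only the apex of a cone has neighbours outside it, and only the empty word leads to the apex. *)
Lemma run_boundary s w z : valid s -> edge G (run s w).1 z -> ~ cone s z ->
  w = [::].
Proof.
move=> vs e nz; apply: (@run_inj s) => //.
exact: cone_boundary (run_cone _ vs) e nz.
Qed.

Lemma run_next_boundary s l w z : valid s -> edge G (run (next s l) w).1 z ->
  ~ cone (next s l) z -> w = [::].
Proof. by move=> /(next_valid l); exact: run_boundary. Qed.

(** Adjacency depends on the words alone. A common first letter is stripped off; otherwise only
    apexes can be adjacent, so each word has at most one letter. *)
Lemma run_edge s t w w' : valid s -> valid t ->
  edge G (run s w).1 (run s w').1 -> edge G (run t w).1 (run t w').1.
Proof.
have nilE s1 t1 l u : valid s1 -> valid t1 ->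
    edge G s1.1 (run (next s1 l) u).1 -> edge G t1.1 (run (next t1 l) u).1.
  move=> v1 v2; rewrite symG => /(run_next_boundary v1) -> /=.
    exact: next_edge.
  by move/(cone_next_seen v1)/seen_neq.
elim: w w' s t => [|l w IHw] [|l' w'] s t vs vt /=.
- by rewrite irrG.
- exact: nilE.
- by rewrite symG => /(nilE s t _ _ vs vt); rewrite symG.
have [<-|ll'] := eqVneq l l'; first by apply: IHw; apply: next_valid.
move=> e.
have ncone l1 l2 u : l1 != l2 -> ~ cone (next s l1) (run (next s l2) u).1.
  move=> /eqP l12 c; apply: l12; apply: (cone_next_inj vs c).
  exact: run_cone (next_valid _ vs).
have w0 : w = [::] by apply: (run_next_boundary vs e); exact: ncone.
have w'0 : w' = [::].
  rewrite symG in e; apply: (run_next_boundary vs e).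
  by apply: ncone; rewrite eq_sym.
rewrite w0 w'0 /= in e *.
have [iB Bs _] := next_blockP l.1 vs.
have [iB' Bs' _] := next_blockP l'.1 vs.
have [[_ Bn] [_ Bn']] := (next_valid l vs, next_valid l' vs).
(* The two ends are adjacent and differ from [s.1], so their blocks see a common vertex and
   coincide. *)
have l1 : l.1 = l'.1.
  apply: (next_block_inj vs).
  apply: (seen_disjoint iB iB' Bs Bs' (z := (next s l').1)).
    apply: seen_edge e _; last exact: next_neq.
    by apply: seen_refl => //; exact: next_neq.
  by apply: seen_refl => //; exact: next_neq.
have [iC Ct _] := next_blockP l.1 vt.
have [[_ Cn] [_ Cn']] := (next_valid l vt, next_valid l' vt).
apply: (block_edge iC) => //; first by rewrite {1}l1.
move=> nn; case/eqP: ll'.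
apply: (cone_next_inj (s := t) (z := (next t l).1)) => //.
  by left.
by left; exact: nn.
Qed.

(** In the inductive step the exceptional neighbours lie in the block of the first letter, so each
    is [s.1] or is reached by a single letter. *)
Lemma run_neighbour s w z : valid s -> edge G (run s w).1 z ->
  (exists w', z = (run s w').1) \/ (vertex s.2 z /\ z <> s.1).
Proof.
elim: w s => [|l w IHw] s vs /= e.
  have zs : z <> s.1 by move=> zs; rewrite zs irrG in e.
  have [B [iB Bs Bz]] := edge_in_block simpleG e.
  have [BP|BP] := pselect (B = s.2); first by right; rewrite -BP.
  have [i iE] := next_block_surj vs iB Bs BP.
  have [a aE] : exists a, next_vertex (s.1, B) a = z.
    by apply: next_vertex_surj.
  by left; exists [:: (i, a)]; rewrite /= iE aE.
have [[w' ->]|[Bz zn]] := IHw _ (next_valid l vs) e.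
  by left; exists (l :: w').
left; have [->|zs] := pselect (z = s.1); first by exists [::].
have [a aE] := next_vertex_surj (next_block_valid l.1 vs) Bz zs.
by exists [:: (l.1, a)]; rewrite /= aE.
Qed.

(** * Global coordinates from a base block *)

Section BaseBlock.
Variable B0 : graph V.
Hypothesis iB0 : is_block G B0.

Lemma base_exists : exists b : 'I_n -> V,
  injective b /\ forall x, vertex B0 x <-> exists i, b i = x.
Proof. exact: card_eq_II_enum (block_card iB0). Qed.

Definition base := sval (cid base_exists).

Lemma base_inj : injective base.
Proof. by have [] := svalP (cid base_exists). Qed.

Lemma base_surj x : vertex B0 x -> exists i, base i = x.
Proof. by have [_ bP] := svalP (cid base_exists); move/bP. Qed.

Lemma base_valid j : valid (base j, B0).
Proof.
split=> //=; have [_ bP] := svalP (cid base_exists).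
by apply/bP; exists j.
Qed.

(** [B0] counts as the entry block of each of its vertices, so the base cones spread out in all
    other directions. *)
Definition code (c : 'I_n * seq letter) : V := (run (base c.1, B0) c.2).1.

Lemma base_cone_disjoint i j z :
  cone (base i, B0) z -> cone (base j, B0) z -> i = j.
Proof.
have [[_ Bi] [_ Bj]] := (base_valid i, base_valid j).
by move=> ci cj; apply: base_inj; exact: cone_sibling ci cj.
Qed.

Lemma code_inj : injective code.
Proof.
move=> [i w] [j w'] e.
have ij : i = j.
  apply: (@base_cone_disjoint _ _ (code (i, w))).
    exact: run_cone (base_valid i).
  by rewrite e; exact: run_cone (base_valid j).
rewrite -ij in e *; congr pair; exact: run_inj (base_valid i) e.
Qed.

(** The coded vertices are closed under adjacency, and [G] is connected. *)
Lemma code_surj x : exists c, code c = x.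
Proof.
have [_ [[[x0 Bx0] _] _ _] _] := iB0.
have [j0 j0E] := base_surj Bx0.
pose P z := exists c, code c = z.
apply: (joined_ind (P := P) _ (joinedT x0 x)); last first.
  by exists (j0, [::]).
move=> u z + [[j w] uE]; rewrite -{u}uE => e.
have [[w' ->]|[/= Bz _]] := run_neighbour (base_valid j) e.
  by exists (j, w').
by have [i <-] := base_surj Bz; exists (i, [::]).
Qed.

Lemma code_bij : bijective code.
Proof.
have /choice[g gP] := code_surj.
by exists g => // c; apply: code_inj; rewrite gP.
Qed.

(** Inside one base cone [run_edge] applies. Between two base cones only the apexes can be adjacent,
    and [B0] is complete. *)
Lemma code_edge (f : 'I_n -> 'I_n) i j w w' : injective f ->
  edge G (code (i, w)) (code (j, w')) ->
  edge G (code (f i, w)) (code (f j, w')).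
Proof.
move=> finj; have [<-|ij] := eqVneq i j.
  exact: run_edge (base_valid _) (base_valid _).
move=> e.
have ncone i1 i2 u : i1 != i2 -> ~ cone (base i1, B0) (code (i2, u)).
  move=> /eqP i12 c; apply: i12; apply: base_cone_disjoint c _.
  exact: run_cone (base_valid _).
have w0 : w = [::] by apply: run_boundary (base_valid i) e _; exact: ncone.
have w'0 : w' = [::].
  rewrite symG in e; apply: run_boundary (base_valid j) e _.
  by apply: ncone; rewrite eq_sym.
rewrite w0 w'0; have [[_ Bi] [_ Bj]] := (base_valid (f i), base_valid (f j)).
by apply: (block_edge iB0) => // /base_inj/finj; exact/eqP.
Qed.

End BaseBlock.

Lemma edge_swap u v : edge G u v -> exists f : V -> V,
  [/\ bijective f, forall x y, edge G (f x) (f y) = edge G x y,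
      f u = v & f v = u].
Proof.
(* With a block through the edge as base block, both ends have the empty word. *)
move=> e; have [B [iB Bu Bv]] := edge_in_block simpleG e.
have [i iE] := base_surj iB Bu; have [j jE] := base_surj iB Bv.
have [g gK Kg] := code_bij iB.
pose t := fun k : 'I_n => if k == i then j else if k == j then i else k.
have tK : involutive t.
  move=> k; rewrite /t; have [->|ki] := eqVneq k i.
    by rewrite eqxx; case: eqVneq.
  have [->|kj] := eqVneq k j; first by rewrite eqxx.
  by rewrite (negPf ki) (negPf kj).
pose f x := code iB (t (g x).1, (g x).2).
have fK : involutive f.
  by move=> x; rewrite /f gK /= tK -surjective_pairing Kg.
have fe x y : edge G x y -> edge G (f x) (f y).
  rewrite -{1}[x]Kg -{1}[y]Kg /f; case: (g x) (g y) => [a w] [b w'].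
  exact: code_edge (inv_inj tK).
have gu : g u = (i, [::]) by rewrite -iE -[base iB i]/(code iB (i, [::])) gK.
have gv : g v = (j, [::]) by rewrite -jE -[base iB j]/(code iB (j, [::])) gK.
exists f; split.
- exact: inv_bij.
(* Since [f] is an involution, preserving edges in one direction suffices. *)
- by move=> x y; apply/idP/idP => [/fe|/fe //]; rewrite !fK.
- by rewrite /f gu /= /t eqxx.
- rewrite /f gv /= /t eqxx; have [ji|//] := eqVneq j i.
  by rewrite ji; exact: iE.
Qed.

(** The neighbours lie in the finitely many finite blocks at [x]. *)
Lemma neighbours_finite x : finite_set [set y | edge G x y].
Proof.
have sub : [set y | edge G x y] `<=`
    \bigcup_(B in [set B | is_block G B /\ vertex B x]) vertex B.
  move=> y /= e; have [B [iB Bx By]] := edge_in_block simpleG e.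
  by exists B.
apply: sub_finite_set sub _; apply: bigcup_finite.
  by apply/finite_setP; exists m; exact: blocks_card.
by move=> B [iB _]; apply/finite_setP; exists n; exact: block_card.
Qed.

Hypotheses (m2 : (2 <= m)%N) (n2 : (2 <= n)%N).
Hypothesis mn : ~ (m = 2%N /\ n = 2%N).

Lemma two_letters : exists l : bool -> letter, injective l.
Proof.
have m1 : (0 < m.-1)%N by case: (m) m2 => [|[]].
have n1 : (0 < n.-1)%N by case: (n) n2 => [|[]].
have [m3|m3] := ltnP 1 m.-1.
  exists (fun b => (if b then Ordinal m3 else Ordinal m1, Ordinal n1)).
  by move=> [] [].
have [n3|n3] := ltnP 1 n.-1.
  exists (fun b => (Ordinal m1, if b then Ordinal n3 else Ordinal n1)).
  by move=> [] [].
(* Both index sets are singletons here, which means [m = n = 2]. *)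
case: mn; move: m2 n2 m3 n3.
by case: (m) => [|[|[]]] //; case: (n) => [|[|[]]].
Qed.

(** Injectivity holds because an extended word determines both the original word and its last
    letter, which records the flag. *)
Lemma doubling_exists : exists c : V * bool -> V,
  injective c /\ forall x b, edge G x (c (x, b)).
Proof.
have [x0 _] : vertex G !=set0 by case: GT => _ _ [].
have [B iB] : exists B, is_block G B.
  have [f [_ fP]] := card_eq_II_enum (blocks_card x0).
  have m0 : (0 < m)%N by case: (m) m2.
  have [] := (fP (f (Ordinal m0))).2; first by exists (Ordinal m0).
  by move=> iB _; exists (f (Ordinal m0)).
have [l linj] := two_letters; have [g gK Kg] := code_bij iB.
have runE s w b : run s (rcons w b) = next (run s w) b.
  by elim: w s => //=.
exists (fun xb => code iB ((g xb.1).1, rcons (g xb.1).2 (l xb.2))); split.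
  move=> [x b] [y b'] /code_inj /= [gxy /rcons_inj [gxy' /linj ->]].
  by rewrite -[x]Kg -[y]Kg [g x]surjective_pairing gxy gxy' -surjective_pairing.
move=> x b; rewrite -{1}[x]Kg /code runE; apply: next_edge.
exact: run_valid (base_valid _ _).
Qed.

End Coding.

(** * Subspaces and pointwise convergence with discrete values *)

Lemma compact_set_type (X : topologicalType) (A : set X) :
  compact A -> compact [set: A].
Proof.
move=> cA F PF _.
have FA : F [set x : A | A (set_val x)].
  by apply: filterE => x; rewrite /= set_valE; exact: set_valP.
have [p [Ap clp]] := cA (set_val @ F) _ FA.
exists (exist _ p (mem_set Ap)); split=> // U W FU [_ [[Q oQ <-] Qp QW]].
have FU' : F [set x : A | (set_val @` U) (set_val x)].
  by move: FU; apply: filterS => x Ux; exists x.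
have nQ : nbhs p Q by move: Qp; rewrite set_valE => Qp; exact: open_nbhs_nbhs.
have [_ [[x Ux <-] Qx]] := clp (set_val @` U) Q FU' nQ.
by exists x; split=> //; exact: QW.
Qed.

Lemma hausdorff_set_type (X : topologicalType) (A : set X) :
  hausdorff_space X -> hausdorff_space A.
Proof.
move=> hX p q clpq; apply: val_inj; apply: hX => U W Up Wq.
have [] := clpq (set_val @^-1` U) (set_val @^-1` W).
- exact: (@initial_continuous A X set_val p).
- exact: (@initial_continuous A X set_val q).
- by move=> x [Ux Wx]; exists (set_val x).
Qed.

Section DiscretePointwise.
Variables I V : choiceType.
Local Notation D := (discrete_topology V).

Lemma nbhs_ptws_discrete (c : {ptws I -> D}) (i : I) :
  nbhs c [set c' : {ptws I -> D} | c' i = c i].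
Proof.
exact: (@proj_continuous I (fun=> D) i c _ (@discrete_set1 D (c i))).
Qed.

Lemma cvg_ptws_discrete (F : set_system {ptws I -> D}) (c : {ptws I -> D}) :
  Filter F -> (forall i, F [set c' : {ptws I -> D} | c' i = c i]) -> F --> c.
Proof.
move=> FF Fi; apply/(@pointwise_cvgP (discrete_topology I) D) => i.
by apply/discrete_cvg; exact: Fi.
Qed.

Lemma hausdorff_ptws_discrete : hausdorff_space {ptws I -> D}.
Proof. by apply: hausdorff_product => _; exact: discrete_hausdorff. Qed.

(** A coincidence of two values involves only two coordinates, so it persists in a neighbourhood. *)
Lemma closed_injective : closed [set c : {ptws I -> D} | injective c].
Proof.
move=> c clc i j cij.
have [c' [c'inj [c'i c'j]]] :=
  clc _ (filterI (nbhs_ptws_discrete c i) (nbhs_ptws_discrete c j)).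
by apply: c'inj; rewrite c'i c'j.
Qed.

End DiscretePointwise.

(** * The compact space of doublings and the mass argument *)

Section Doublings.
Variables (V : choiceType) (C : Type) (S : V -> V -> C) (e : rel V).
Hypothesis e_finite : forall x, finite_set [set y | e x y].
Hypothesis e_autom : forall (g : autom S) x y, e (g x) (g y) = e x y.

Definition doubling_fun := {ptws (V * bool)%type -> discrete_topology V}.

Definition doublings : set doubling_fun :=
  [set c : doubling_fun | forall z, e z.1 (c z)] `&`
  [set c : doubling_fun | injective c].

(** By Tychonoff the product of the finite neighbour sets is compact, and injectivity is a closed
    condition. *)
Lemma doublings_compact : compact doublings.
Proof.
apply: compact_closedI; last exact: closed_injective.
apply: (@tychonoff (V * bool)%type (fun=> discrete_topology V)
  (fun z => [set y | e z.1 y])) => z.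
exact/finite_compact/e_finite.
Qed.

Definition doubling_conj (g : autom S) (c : doubling_fun) : doubling_fun :=
  fun z => g (c ((g^-1)%g z.1, z.2)).

Lemma autom_gK (g : autom S) : cancel (g^-1)%g g.
Proof. exact: autom_invKV. Qed.

Lemma autom_Kg (g : autom S) : cancel g (g^-1)%g.
Proof. exact: autom_invK. Qed.

Lemma doubling_conjP g c : doublings c -> doublings (doubling_conj g c).
Proof.
move=> [ec cinj]; split=> [z|[x b] [y b']] /=.
  by rewrite -{1}[z.1](autom_gK g) e_autom; apply: (ec (_, _)).
move=> /(can_inj (autom_Kg g)) /cinj [xy ->].
by rewrite (can_inj (autom_gK g) xy).
Qed.

Lemma set_val_doubling (c : doublings) : doublings (set_val c).
Proof. by rewrite set_valE; exact: set_valP. Qed.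

Definition doubling_act (g : autom S) (c : doublings) : doublings :=
  exist _ (doubling_conj g (set_val c)) 
    (mem_set (doubling_conjP g (set_val_doubling c))).

Lemma nbhs_doubling (c : doublings) z :
  nbhs c [set c' : doublings | set_val c' z = set_val c z].
Proof.
exact: (@initial_continuous doublings _ set_val c _ (nbhs_ptws_discrete _ z)).
Qed.

Lemma doubling_actE g c z :
  set_val (doubling_act g c) z = g (set_val c ((g^-1)%g z.1, z.2)).
Proof. by rewrite set_valE. Qed.

Lemma set_val_inj (c c' : doublings) : set_val c =1 set_val c' -> c = c'.
Proof.
move=> cc'; apply: val_inj; apply/funext => z.
by have := cc' z; rewrite set_valE.
Qed.

Lemma doubling_act_continuous : continuous_action doubling_act.
Proof.
split.
- by move=> c; apply: set_val_inj => -[x b]; rewrite doubling_actE invg1.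
- move=> g h c; apply: set_val_inj => -[x b].
  by rewrite !doubling_actE invgM.
- apply: continuous_comp_initial => -[g c].
  apply: cvg_ptws_discrete => -[x b].
  (* The value at [(x, b)] is [g w]; it stays fixed while the automorphism is fixed at [u] and [w]
     and the doubling at [(u, b)]. *)
  pose u := (g^-1)%g x; pose w := set_val c (u, b).
  exists ([set g' : autom S | g' u = g u] `&` [set g' : autom S | g' w = g w],
      [set c' : doublings | set_val c' (u, b) = w]).
    split=> /=; last exact: nbhs_doubling.
    by apply: filterI; exact: nbhs_autom.
  move=> [g' c'] /= [[g'u g'w] c'u].
  have g'x : (g'^-1)%g x = u.
    by apply: (can_inj (autom_Kg g')); rewrite autom_gK g'u autom_gK.
  by rewrite !doubling_actE /= g'x c'u.
Qed.

Definition doubling_event (b : bool) (x y : V) : set doublings :=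
  [set c : doublings | set_val c (x, b) = y].

Lemma doubling_event_open b x y : open (doubling_event b x y).
Proof.
rewrite openE => c cxy; rewrite /interior /=.
move: (nbhs_doubling c (x, b)); apply: filterS => c' /=.
by rewrite cxy.
Qed.

Lemma doubling_act_event g b x y :
  doubling_act g @^-1` doubling_event b (g x) (g y) = doubling_event b x y.
Proof.
apply/seteqP; split=> c; rewrite /doubling_event /= doubling_actE /= autom_Kg.
  exact: (can_inj (autom_Kg g)).
by move=> ->.
Qed.

Hypothesis e_swap : forall u v, e u v -> exists g : autom S, g u = v /\ g v = u.

Lemma doubling_not_amenable (R : realType) (x : V) (c0 : V * bool -> V) :
  injective c0 -> (forall y b, e y (c0 (y, b))) -> ~ amenable R (autom S).
Proof.
move=> c0inj ec0 am.
have Kc0 : doublings c0 by split=> // -[y b] /=.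
pose pt : doublings := exist _ (c0 : doubling_fun) (mem_set Kc0).
(* The given doubling [c0] is the base point, which makes the space nonempty. *)
pose X : ptopologicalType := HB.pack (set_type doublings)
  (isPointed.Build (set_type doublings) pt).
have [mu muP] := am X (compact_set_type doublings_compact)
  (hausdorff_set_type (@hausdorff_ptws_discrete _ _)) _ doubling_act_continuous.
have mE b u v : measurable (doubling_event b u v : set (borel X)).
  by apply: sub_sigma_algebra; exact: doubling_event_open.
(* An automorphism swapping [u] and [v] pulls the event for [(u, v)] back to the event for
   [(v, u)]. *)
have mu_sym b u v : e u v ->
    mu (doubling_event b u v) = mu (doubling_event b v u).
  move=> /e_swap[g [gu gv]].
  by rewrite -(muP g) // -{1}gu -{1}gv doubling_act_event.
pose N := [set y | e x y].
have finN : finite_set N by exact: e_finite.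
(* Every doubling sends [(x, b)] to exactly one neighbour of [x], so these events partition the
   space. *)
have out b : (\sum_(y \in N) mu (doubling_event b x y) = 1)%E.
  have tE : trivIset N (doubling_event b x) by move=> y y' _ _ [c [/= <- <-]].
  rewrite -(measure_fin_bigcup mu finN tE (fun y _ => mE b x y)).
  rewrite -[RHS](probability_setT mu); congr (mu _).
  apply/seteqP; split=> // c _; exists (set_val c (x, b)) => //=.
  by have [/(_ (x, b))] := set_val_doubling c.
(* The event that [x] is hit with flag [b]; injectivity makes the union disjoint, and symmetry gives
   it the outgoing mass 1. *)
pose inn b := \bigcup_(y in N) doubling_event b y x.
have mu_in b : mu (inn b : set (borel X)) = 1%E.
  have tE : trivIset N (fun y => doubling_event b y x).
    move=> y y' _ _ [c [/= cy cy']]; have [_ cinj] := set_val_doubling c.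
    by have [] : (y, b) = (y', b) by apply: cinj; rewrite cy cy'.
  rewrite (measure_fin_bigcup mu finN tE (fun y _ => mE b y x)).
  rewrite -(out b); apply: eq_fsbigr => y; rewrite inE => exy.
  exact/esym/mu_sym.
have min b : measurable (inn b : set (borel X)).
  by apply: fin_bigcup_measurable => // y _; exact: mE.
(* By injectivity [x] is not hit with both flags, so two disjoint events of mass 1 would give
   [1 + 1 <= 1]. *)
have in_disjoint : inn true `&` inn false = set0.
  apply/seteqP; split=> // c [[y _ cy] [y' _ cy']].
  have [_ cinj] := set_val_doubling c.
  by have : (y, true) = (y', false) by apply: cinj; rewrite cy cy'.
have : (mu (inn true `|` inn false : set (borel X)) <= 1)%E.
  by apply: probability_le1; exact: measurableU.
have -> : (mu (inn true `|` inn false : set (borel X)) =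
    mu (inn true) + mu (inn false))%E by exact: measureU.
by rewrite !mu_in -EFinD lee_fin Num.Theory.gerDl Num.Theory.ler10.
Qed.

End Doublings.

(** * Adjacency and the path metric determine each other *)

Section GraphDist.
Variables (V : eqType) (G : graph V).

Lemma graph_distP x y k : walk G x y k ->
  walk G x y (graph_dist G x y) /\
  forall j, walk G x y j -> (graph_dist G x y <= j)%N.
Proof.
move=> wk; rewrite /graph_dist.
have [i /asboolP wi imin] : {i | `[< walk G x y i >] &
    forall j, `[< walk G x y j >] -> (i <= j)%N}.
  apply: (find_ex_minn (P := fun i => `[< walk G x y i >])).
  by exists k; apply/asboolP.
have /(xgetI 0%N) : [set k | walk G x y k /\
    forall j, walk G x y j -> (k <= j)%N] i.
  by split=> // j wj; apply: imin; apply/asboolP.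
by [].
Qed.

(** An edge gives distance at most 1, and distance 0 would make it a loop. Conversely the junk value
    is 0, so a distance of 1 is attained by a walk. *)
Lemma edge_graph_dist x y :
  simple_graph G -> edge G x y = (graph_dist G x y == 1%N).
Proof.
move=> [_ iG _]; apply/idP/eqP => [e|d1].
  have w1 : walk G x y 1 by exists [:: y]; rewrite /= e.
  have [w dmin] := graph_distP w1.
  have := dmin _ w1; case: (graph_dist G x y) w => [|[]] //.
  by move=> [[|? ?] [//= _ xy _]] _; rewrite xy iG in e.
have [[p [ep lp]]|nw] := pselect (walk G x y 1).
  by case: p ep lp => [|z []] //=; rewrite andbT => e <-.
have [[k wk]|nwk] := pselect (exists k, walk G x y k).
  by have [] := graph_distP wk; rewrite d1.
move: d1; rewrite /graph_dist xgetPN // => k [wk _].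
by apply: nwk; exists k.
Qed.

Lemma graph_dist_autom (f : V -> V) :
  bijective f -> (forall x y, edge G (f x) (f y) = edge G x y) ->
  forall x y, graph_dist G (f x) (f y) = graph_dist G x y.
Proof.
move=> [g fK gK] fe x y; rewrite /graph_dist.
suff wE : walk G (f x) (f y) = walk G x y by rewrite wE.
apply/funext => k; apply/propext; split=> -[p [ep lp sp]].
  exists (map g p); split; last by rewrite size_map.
    rewrite -(fK x) path_map; apply: sub_path ep => u w /=.
    by rewrite -{1}[u]gK -{1}[w]gK fe.
  by rewrite -(fK x) last_map lp fK.
exists (map f p); rewrite size_map sp last_map lp; split=> //.
by rewrite path_map; apply: sub_path ep => u w /=; rewrite fe.
Qed.

End GraphDist.

Theorem theorem9p8 (R : realType) (m n : nat) (V : countType) (T : graph V) :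
  (2 <= m)%N -> (2 <= n)%N -> is_T m n T ->
  ~ (m = 2%N /\ n = 2%N) ->
  ~ amenable R (graph_aut T) /\ ~ amenable R (isometry_group T).
Proof.
move=> m2 n2 TT mn.
have simpleT : simple_graph T by case: TT.
have [x _] : vertex T !=set0 by case: TT => _ _ [].
have [c [cinj ec]] := doubling_exists TT m2 n2 mn.
have fin := neighbours_finite TT.
(* Both groups act on the same doublings along [edge T]; isometries preserve adjacency because it is
   distance 1, and the swaps preserve the distance. *)
split; apply: (doubling_not_amenable fin _ _ x cinj ec).
- by move=> g u v; exact: autom_pres.
- move=> u v /(edge_swap TT)[f [bf ef fu fv]].
  by exists (Autom bf ef).
- by move=> g u v; rewrite !edge_graph_dist // autom_pres.
- move=> u v /(edge_swap TT)[f [bf ef fu fv]].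
  by exists (Autom bf (graph_dist_autom bf ef)).
Qed.
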